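(* Let $K$ be a field, $Q$ a finite quiver, and $\succ$ a length admissible order on the set $\mathcal B$ of paths of $Q$. If $\Lambda=KQ/I$ is a strong Koszul algebra (with respect to $I$ and $\succ$), then $\Lambda\in\mathrm{GrAlg}(\mathcal T)$, where $\mathcal T$ is the (unique) minimal set of paths generating the ideal $\langle \mathrm{tip}(I)\rangle$.
   Context: $KQ$ is the path algebra, $\mathcal B$ the set of all finite directed paths in $Q$ (vertices are paths of length $0$), $\ell(p)$ the length of a path; paths are written left to right, so a path $p$ from $v$ to $w$ satisfies $vpw=p$. ''Ideal'' means two-sided ideal and $\langle X\rangle$ is the two-sided ideal generated by $X$. A length admissible order is a well-order $\succ$ on $\mathcal B$ such that for $p,q,r,s,t\in\mathcal B$: $p\succ q$ implies $pr\succ qr$ if both are nonzero; $p\succ q$ implies $sp\succ sq$ if both are nonzero; $p=rqt$ implies $p\succeq q$; and $\ell(p)>\ell(q)$ implies $p\succ q$. For nonzero $x=\sum_{p\in\mathcal B}\alpha_p p\in KQ$, $\mathrm{tip}(x)$ is the $\succ$-largest $p$ with $\alpha_p\neq 0$; for $X\subseteq KQ$, $\mathrm{tip}(X)=\{\mathrm{tip}(x): x\in X, x\ne 0\}$. A nonzero $x$ is uniform if $x=vxw$ for some vertices $v,w$; an element is quadratic if it is a $K$-linear combination of paths of length $2$. An ideal is graded if it is generated by length homogeneous elements. A Gröbner basis of a graded ideal $I$ is a set $\mathcal G\subseteq I$ of length homogeneous uniform elements with $\langle\mathrm{tip}(\mathcal G)\rangle=\langle \mathrm{tip}(I)\rangle$.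 $KQ/I$ is a strong Koszul algebra (with respect to $I$ and $\succ$) if $I$ has a Gröbner basis with respect to $\succ$ consisting of quadratic elements. Every ideal generated by paths has a unique minimal generating set of paths; for a strong Koszul algebra the minimal set for $\langle\mathrm{tip}(I)\rangle$ consists of paths of length $2$. Given a set $\mathcal T$ of paths of length $2$: $\mathcal N=\mathcal B\setminus \mathrm{tip}(\langle\mathcal T\rangle)$ (the paths having no subpath in $\mathcal T$); $\mathcal N_2$ is the set of paths of length $2$ in $\mathcal N$; for $t\in\mathcal T$, $\mathcal N_2(t)$ is the set of $n\in\mathcal N_2$ with $t\succ n$ and $n$ having the same start vertex and the same end vertex as $t$. Put $D=\sum_{t\in\mathcal T}|\mathcal N_2(t)|$ and $\mathcal A=K^D$, with points written $X=(x_{t,n})_{t\in\mathcal T,\,n\in\mathcal N_2(t)}$. For $X\in\mathcal A$, $\mathcal G(X)=\{g_t : t\in\mathcal T\}$ with $g_t=t-\sum_{n\in\mathcal N_2(t)}x_{t,n}n$. Finally $\mathrm{GrAlg}(\mathcal T)=\{X\in\mathcal A : KQ/\langle \mathcal G(X)\rangle$ is a strong Koszul algebra with respect to $\langle\mathcal G(X)\rangle$ and $\succ\}$. One writes $KQ/I\in\mathrm{GrAlg}(\mathcal T)$ if $I=\langle\mathcal G(X)\rangle$ for some $X\in \mathrm{GrAlg}(\mathcal T)$. *)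

(* Defs.v *)
From HB Require Import structures.
From mathcomp Require Import all_boot all_order all_algebra.
From mathcomp Require Import finmap monalg.
From mathcomp Require Import boolp classical_sets.

Set Implicit Arguments.
Unset Strict Implicit.
Unset Printing Implicit Defensive.

Import GRing.Theory.
Local Open Scope ring_scope.
Local Open Scope classical_set_scope.

Record quiver := Quiver {
  vertex : finType;
  arrow : finType;
  asrc : arrow -> vertex;
  atgt : arrow -> vertex }.

Section Paths.
Variable Q : quiver.
Implicit Types (v : vertex Q) (s : seq (arrow Q)).

Fixpoint walk v s : bool :=
  if s is a :: s' then (asrc a == v) && walk (atgt a) s' else true.

Definition walk_end v s := last v (map (@atgt Q) s).

(* A path is its start vertex together with its arrows, listed left to right;
   the start vertex is what distinguishes the paths of length 0. *)
Record qpath := QPath {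
  qpath_val :> vertex Q * seq (arrow Q);
  _ : walk qpath_val.1 qpath_val.2 }.

HB.instance Definition _ := [isSub for qpath_val].
(* Opaque decision procedures, for unification not to unfold them. *)
HB.instance Definition _ := gen_eqMixin qpath.
HB.instance Definition _ := gen_choiceMixin qpath.

Implicit Types p q r : qpath.

Definition psrc p := (val p).1.
Definition ptgt p := walk_end (val p).1 (val p).2.
Definition plen p := size (val p).2.

Definition vpath v : qpath := @QPath (v, [::]) isT.

(* Concatenation in the sense of [B `|` {0}]: [None] stands for the zero
   product; [pcatE] shows that [insub] never fails here. *)
Definition pcat p q : option qpath :=
  if ptgt p == psrc q then insub (psrc p, (val p).2 ++ (val q).2) else None.

Lemma walk_cat v s1 s2 :
  walk v (s1 ++ s2) = walk v s1 && walk (walk_end v s1) s2.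
Proof. by elim: s1 v => //= a s1 IH v; rewrite IH andbA. Qed.

Lemma walk_end_cat v s1 s2 :
  walk_end v (s1 ++ s2) = walk_end (walk_end v s1) s2.
Proof. by rewrite /walk_end map_cat last_cat. Qed.

Lemma pcatE p q : ptgt p = psrc q ->
  exists2 r, pcat p q = Some r & val r = (psrc p, (val p).2 ++ (val q).2).
Proof.
move=> pq; rewrite /pcat pq eqxx; case: insubP => [r _ <- | /=]; first by exists r.
case: p q pq => [[v s1] /= w1] [[w s2] /= w2]; rewrite /ptgt /psrc /= => pq.
by rewrite walk_cat w1 pq w2.
Qed.

Lemma pcatN p q : ptgt p != psrc q -> pcat p q = None.
Proof. by rewrite /pcat => /negPf ->. Qed.

Lemma pcatA p q r :
  obind (pcat p) (pcat q r) = obind (fun pq => pcat pq r) (pcat p q).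
Proof.
case: (eqVneq (ptgt q) (psrc r)) => [qr | qr]; last first.
  rewrite (pcatN qr) /=; case: (eqVneq (ptgt p) (psrc q)) => [pq|/pcatN-> //].
  have [x -> Ex] := pcatE pq; rewrite /= pcatN // /ptgt Ex /= walk_end_cat.
  by move: pq; rewrite /ptgt /psrc => ->.
have [y Ey Vy] := pcatE qr; rewrite Ey /=.
case: (eqVneq (ptgt p) (psrc q)) => [pq | pq]; last first.
  by rewrite (pcatN pq) pcatN // /psrc Vy.
have [x Ex Vx] := pcatE pq; rewrite Ex /=.
have py : ptgt p = psrc y by rewrite /psrc Vy.
have xr : ptgt x = psrc r.
  by rewrite /ptgt Vx /= walk_end_cat -qr; move: pq; rewrite /ptgt /psrc => ->.
have [a -> Va] := pcatE py; have [b -> Vb] := pcatE xr.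
by congr Some; apply: val_inj; rewrite Va Vb /psrc Vx Vy /= catA.
Qed.

Lemma pcat1p v p : pcat (vpath v) p = if v == psrc p then Some p else None.
Proof.
case: (eqVneq v (psrc p)) => [-> | vp]; last exact: pcatN.
have [|r -> Vr] := @pcatE (vpath (psrc p)) p; first by [].
by congr Some; apply: val_inj; rewrite Vr /psrc /=; case: (val p).
Qed.

Lemma pcatp1 v p : pcat p (vpath v) = if ptgt p == v then Some p else None.
Proof.
case: (eqVneq (ptgt p) v) => [<- | vp]; last exact: pcatN.
have [|r -> Vr] := @pcatE p (vpath (ptgt p)); first by [].
by congr Some; apply: val_inj; rewrite Vr /psrc /= cats0; case: (val p).
Qed.

Definition npath n := {p : qpath | plen p == n}.

Section NPathFinite.
Variable n : nat.

Definition npath_code (p : npath n) : vertex Q * n.-tuple (arrow Q) :=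
  (psrc (val p), Tuple (valP p)).

Definition npath_decode (c : vertex Q * n.-tuple (arrow Q)) :
  option (npath n) := obind insub (insub (c.1, val c.2)).

Lemma npath_codeK : pcancel npath_code npath_decode.
Proof.
move=> p; rewrite /npath_decode /npath_code /= /psrc -surjective_pairing.
by rewrite valK /= valK.
Qed.

HB.instance Definition _ := Choice.on (npath n).
HB.instance Definition _ := PCanIsCountable npath_codeK.
HB.instance Definition _ := isFinite.Build (npath n) (pcan_enumP npath_codeK).

End NPathFinite.

End Paths.

Definition path_alg (K : fieldType) (Q : quiver) : Type := {malg K[qpath Q]}.

HB.instance Definition _ (K : fieldType) (Q : quiver) :=
  GRing.Lmodule.on (path_alg K Q).

Definition pmul2 (K : fieldType) (Q : quiver) (c d : K) (p q : qpath Q) :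
    path_alg K Q :=
  if pcat p q is Some r then << c * d *g r >> else 0.

Definition pa_mul (K : fieldType) (Q : quiver) (x y : path_alg K Q) :
    path_alg K Q :=
  \sum_(p <- msupp x) \sum_(q <- msupp y) pmul2 x@_p y@_q p q.


Section BilinearSums.
Variables (V : nmodType) (op : V -> V -> V) (I : Type).
Hypotheses (opDl : left_distributive op +%R) (opDr : right_distributive op +%R).
Hypotheses (op0l : left_zero 0 op) (op0r : right_zero 0 op).
Implicit Types (r : seq I) (F G H : I -> V) (x : V).

Lemma op_suml r F x : op (\sum_(i <- r) F i) x = \sum_(i <- r) op (F i) x.
Proof. exact: (big_morph (op^~ x) (fun a b => opDl a b x) (op0l x)). Qed.

Lemma op_sumr r F x : op x (\sum_(i <- r) F i) = \sum_(i <- r) op x (F i).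
Proof. exact: (big_morph (op x) (opDr x) (op0r x)). Qed.

Lemma sum_assoc r1 r2 r3 F G H :
  (forall i j k, op (F i) (op (G j) (H k)) = op (op (F i) (G j)) (H k)) ->
  op (\sum_(i <- r1) F i) (op (\sum_(i <- r2) G i) (\sum_(i <- r3) H i)) =
  op (op (\sum_(i <- r1) F i) (\sum_(i <- r2) G i)) (\sum_(i <- r3) H i).
Proof.
move=> opA; rewrite !op_suml; apply/eq_bigr => i _.
rewrite !(op_suml r2, op_sumr r2); apply/eq_bigr => j _.
by rewrite !op_sumr; apply/eq_bigr => k _.
Qed.

End BilinearSums.

Section PathAlgebra.
Variables (K : fieldType) (Q : quiver).
Local Notation KQ := (path_alg K Q).

Implicit Types (x y z : KQ) (p q : qpath Q) (c d : K).

Definition pelt p : KQ := << p >>.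

Definition pa_one : KQ := \sum_(v : vertex Q) pelt (vpath v).

Lemma pmul2_0l d p q : pmul2 0 d p q = 0.
Proof. by rewrite /pmul2; case: pcat => // r; rewrite mul0r monalgU0. Qed.

Lemma pmul2_0r c p q : pmul2 c 0 p q = 0.
Proof. by rewrite /pmul2; case: pcat => // r; rewrite mulr0 monalgU0. Qed.

Lemma pa_mulw (d1 d2 : {fset qpath Q}) x y :
  (msupp x `<=` d1)%fset -> (msupp y `<=` d2)%fset ->
  pa_mul x y = \sum_(p <- d1) \sum_(q <- d2) pmul2 x@_p y@_q p q.
Proof.
move=> le1 le2; rewrite /pa_mul (big_fset_incl _ le1) /=.
  apply/eq_bigr => p _; apply/big_fset_incl => // q _ /mcoeff_outdom ->.
  by rewrite pmul2_0r.
by move=> p _ /mcoeff_outdom xp; rewrite big1 // => q _; rewrite xp pmul2_0l.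
Qed.

Lemma pa_mulUU c d p q :
  pa_mul << c *g p >> << d *g q >> = pmul2 c d p q.
Proof. by rewrite (pa_mulw msuppU_le msuppU_le) !big_seq_fset1 !mcoeffUU. Qed.

Lemma pa_mulDl : left_distributive (@pa_mul K Q) +%R.
Proof.
move=> x y z; rewrite (pa_mulw (msuppD_le x y) (fsubset_refl _)).
rewrite (pa_mulw (fsubsetUl (msupp x) (msupp y)) (fsubset_refl _)).
rewrite (pa_mulw (fsubsetUr (msupp x) (msupp y)) (fsubset_refl _)).
rewrite -big_split /=; apply/eq_bigr => p _.
rewrite -big_split /=; apply/eq_bigr => q _.
by rewrite mcoeffD /pmul2; case: pcat => [r|]; rewrite ?addr0 // mulrDl monalgUD.
Qed.

Lemma pa_mulDr : right_distributive (@pa_mul K Q) +%R.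
Proof.
move=> z x y; rewrite (pa_mulw (fsubset_refl _) (msuppD_le x y)).
rewrite (pa_mulw (fsubset_refl _) (fsubsetUl (msupp x) (msupp y))).
rewrite (pa_mulw (fsubset_refl _) (fsubsetUr (msupp x) (msupp y))).
rewrite -big_split /=; apply/eq_bigr => p _.
rewrite -big_split /=; apply/eq_bigr => q _.
by rewrite mcoeffD /pmul2; case: pcat => [r|]; rewrite ?addr0 // mulrDr monalgUD.
Qed.

Lemma pa_mul0l : left_zero 0 (@pa_mul K Q).
Proof. by move=> x; rewrite /pa_mul msupp0 big_seq_fset0. Qed.

Lemma pa_mul0r : right_zero 0 (@pa_mul K Q).
Proof.
by move=> x; rewrite /pa_mul big1 // => p _; rewrite msupp0 big_seq_fset0.
Qed.

Lemma pmul2A c d e p q r :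
  pa_mul << c *g p >> (pmul2 d e q r) = pa_mul (pmul2 c d p q) << e *g r >>.
Proof.
have := pcatA p q r; rewrite /pmul2.
case: (pcat q r) => [a|]; case: (pcat p q) => [b|] /= E.
- by rewrite (pa_mulUU c _ p a) (pa_mulUU _ e b r) /pmul2 E mulrA.
- by rewrite (pa_mulUU c _ p a) pa_mul0l /pmul2 E.
- by rewrite (pa_mulUU _ e b r) pa_mul0r /pmul2 -E.
- by rewrite pa_mul0l pa_mul0r.
Qed.

Lemma pa_mulA : associative (@pa_mul K Q).
Proof.
move=> x y z; rewrite (monalgE x) (monalgE y) (monalgE z).
apply: (sum_assoc pa_mulDl pa_mulDr pa_mul0l pa_mul0r) => p q r.
by rewrite (pa_mulUU _ _ q r) (pa_mulUU _ _ p q) pmul2A.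
Qed.

Lemma pa_mul1l : left_id pa_one (@pa_mul K Q).
Proof.
move=> x; rewrite (monalgE x) (op_sumr pa_mulDr pa_mul0r).
apply/eq_bigr => p _; rewrite (op_suml pa_mulDl pa_mul0l).
rewrite (bigD1 (psrc p)) //= (pa_mulUU _ _ _ p) /pmul2 pcat1p eqxx mul1r.
rewrite big1 ?addr0 // => v vp.
by rewrite (pa_mulUU _ _ _ p) /pmul2 pcat1p (negPf vp).
Qed.

Lemma pa_mul1r : right_id pa_one (@pa_mul K Q).
Proof.
move=> x; rewrite (monalgE x) (op_suml pa_mulDl pa_mul0l).
apply/eq_bigr => p _; rewrite (op_sumr pa_mulDr pa_mul0r).
rewrite (bigD1 (ptgt p)) //= (pa_mulUU _ _ p) /pmul2 pcatp1 eqxx mulr1.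
rewrite big1 ?addr0 // => v vp.
by rewrite (pa_mulUU _ _ p) /pmul2 pcatp1 eq_sym (negPf vp).
Qed.

(* Only a possibly zero ring: the quiver may have no vertex. *)
HB.instance Definition _ := GRing.Zmodule_isPzRing.Build KQ
  pa_mulA pa_mul1l pa_mul1r pa_mulDl pa_mulDr.

Lemma pelt_mul p q : pelt p * pelt q = oapp pelt 0 (pcat p q).
Proof. by rewrite [LHS]pa_mulUU /pmul2 mulr1; case: pcat. Qed.

Lemma pa_scalerAl c x y : c *: (x * y) = (c *: x) * y.
Proof.
have sU d (r : qpath Q) : c *: (<< d *g r >> : KQ) = << c * d *g r >>.
  by apply/malgP => k; rewrite mcoeffZ !mcoeffU mulrnAr.
rewrite -[x * y]/(pa_mul x y) -[RHS]/(pa_mul (c *: x) y).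
rewrite (pa_mulw (msuppZ_le c x) (fsubset_refl _)) /pa_mul scaler_sumr.
apply/eq_bigr => p _; rewrite scaler_sumr; apply/eq_bigr => q _.
by rewrite mcoeffZ /pmul2; case: pcat => [r|]; rewrite ?scaler0 // sU mulrA.
Qed.

(* Two-sided ideals; closure under scaling and opposite follows from
   [pa_scalerAl], the ring being unital. *)
Record is_ideal (I : set KQ) : Prop := IsIdeal {
  ideal0 : I 0;
  idealD : forall x y, I x -> I y -> I (x + y);
  idealMl : forall a x, I x -> I (a * x);
  idealMr : forall a x, I x -> I (x * a) }.

Definition ideal_gen (X : set KQ) : set KQ :=
  [set x | forall I, is_ideal I -> X `<=` I -> I x].

Definition path_ideal (S : set (qpath Q)) : set KQ := ideal_gen (pelt @` S).

Definition min_path_gen (J : set KQ) (S : set (qpath Q)) : Prop :=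
  path_ideal S = J /\
  forall S', S' `<=` S -> path_ideal S' = J -> S' = S.

Definition uniform x : Prop :=
  x != 0 /\ exists v w, x = pelt (vpath v) * x * pelt (vpath w).

Definition homogeneous x : Prop :=
  exists d : nat, forall p, p \in msupp x -> plen p = d.

Definition quadratic x : Prop := forall p, p \in msupp x -> plen p = 2%N.

Definition graded_ideal (I : set KQ) : Prop :=
  is_ideal I /\ exists2 X : set KQ, X `<=` homogeneous & I = ideal_gen X.

End PathAlgebra.

Arguments pelt K {Q} p.
Arguments path_ideal K {Q} S _.

Record length_admissible (Q : quiver) (gt : qpath Q -> qpath Q -> Prop) : Prop :=
  LengthAdmissible {
    la_irr : forall p, ~ gt p p;
    la_trans : forall p q r, gt p q -> gt q r -> gt p r;
    la_total : forall p q, p <> q -> gt p q \/ gt q p;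
    la_least : forall S : set (qpath Q), S !=set0 ->
      exists2 m, S m & forall p, S p -> p = m \/ gt p m;
    la_mulr : forall p q r pr qr, gt p q ->
      pcat p r = Some pr -> pcat q r = Some qr -> gt pr qr;
    la_mull : forall p q s sp sq, gt p q ->
      pcat s p = Some sp -> pcat s q = Some sq -> gt sp sq;
    la_sub : forall p q r t rq, pcat r q = Some rq -> pcat rq t = Some p ->
      p = q \/ gt p q;
    la_len : forall p q, (plen q < plen p)%N -> gt p q }.

Section StrongKoszul.
Variables (K : fieldType) (Q : quiver) (gt : qpath Q -> qpath Q -> Prop).
Local Notation KQ := (path_alg K Q).

(* Holds for no [p] when [x = 0]. *)
Definition is_tip (x : KQ) (p : qpath Q) : Prop :=
  p \in msupp x /\ forall q, q \in msupp x -> q <> p -> gt p q.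

Definition tips (X : set KQ) : set (qpath Q) :=
  [set p | exists2 x, X x & is_tip x p].

Definition groebner (I G : set KQ) : Prop :=
  [/\ G `<=` I,
      forall g, G g -> homogeneous g /\ uniform g
    & path_ideal K (tips G) = path_ideal K (tips I)].

Definition strong_koszul (I : set KQ) : Prop :=
  graded_ideal I /\
  exists2 G, groebner I G & forall g, G g -> quadratic g.

Section GrAlg.
Variable T : set (qpath Q).

Definition nontips : set (qpath Q) := ~` tips (path_ideal K T).

Definition N2 : set (qpath Q) := [set n | nontips n /\ plen n = 2%N].

Definition N2_of (t : qpath Q) : set (qpath Q) :=
  [set n | [/\ N2 n, gt t n, psrc n = psrc t & ptgt n = ptgt t]].

(* The pairs [(t, n)] with [t] in [T] and [n] in [N2_of t]; there are [D] of
   them, so that [affine_space] is [K^D]. *)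
Definition pairTN :=
  {tn : npath Q 2 * npath Q 2 |
    `[< T (val tn.1) /\ N2_of (val tn.1) (val tn.2) >]}.

Definition pair_t (i : pairTN) : qpath Q := val (val i).1.
Definition pair_n (i : pairTN) : qpath Q := val (val i).2.

Definition affine_space := {ffun pairTN -> K}.

Definition gelt (X : affine_space) (t : qpath Q) : KQ :=
  pelt K t - \sum_(i : pairTN | pair_t i == t) X i *: pelt K (pair_n i).

Definition gset (X : affine_space) : set KQ := gelt X @` T.

Definition GrAlg : set affine_space :=
  [set X | strong_koszul (ideal_gen (gset X))].

(* [KQ / I] is in [GrAlg T], a notion reserved to sets [T] of paths of
   length 2. *)
Definition in_GrAlg (I : set KQ) : Prop :=
  (forall t, T t -> plen t = 2%N) /\
  exists2 X, GrAlg X & I = ideal_gen (gset X).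

End GrAlg.

End StrongKoszul.

(* Main.v *)
From mathcomp Require Import all_boot all_order all_algebra.
From mathcomp Require Import finmap monalg.
From mathcomp Require Import boolp classical_sets.
Require Import Defs.

(** Write [J] for the monomial ideal generated by [tips gt I], and let [G] be a
    quadratic Gröbner basis of [I].

    The tips of [G] generate [J], and they all have length 2, so none of them
    is a proper subpath of another.  Membership of a path in a monomial ideal
    means having a generator as a subpath ([path_idealE]), hence such an
    antichain is the only minimal generating set of [J]
    ([min_path_gen_antichain]).  Thus [T] is the set of tips of [G], and its
    elements have length 2.

    Each [t] in [T] is then the tip of a uniform quadratic element of [I]; in
    other words [t] is congruent modulo [I] to a combination of smaller paths
    of length 2 with the same end vertices as [t].  Those among them that lie
    in [T] can be rewritten in turn; the order being well-founded, this ends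
    with a combination [r t] of paths in [N2_of t] ([reduce_quadratic]).  The
    coefficients of the [r t] are the coordinates of a point [X] with
    [gelt X t = t - r t] ([gelt_reduced]).

    The [gelt X t] lie in [I] and the tip of any element of [I] has some [t]
    in [T] as a subpath, so the division algorithm reduces every element of
    [I] to 0 modulo [gset X] ([ideal_sub_division]).  Hence
    [I = ideal_gen (gset X)], and the condition [GrAlg X] is the
    hypothesis on [I]. *)

Set Implicit Arguments.
Unset Strict Implicit.
Unset Printing Implicit Defensive.

Import GRing.Theory.
Local Open Scope ring_scope.
Local Open Scope classical_set_scope.

(** * Subpaths *)

Section Subpaths.
Variable Q : quiver.
Implicit Types p q r s : qpath Q.

Lemma pcat_assocl p q r qr x : pcat q r = Some qr -> pcat p qr = Some x ->
  exists2 pq, pcat p q = Some pq & pcat pq r = Some x.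
Proof.
move=> Eqr Ex; have := pcatA p q r; rewrite Eqr /= Ex.
by case: (pcat p q) => //= pq Ey; exists pq.
Qed.

Lemma pcat_assocr p q r pq x : pcat p q = Some pq -> pcat pq r = Some x ->
  exists2 qr, pcat q r = Some qr & pcat p qr = Some x.
Proof.
move=> Epq Ex; have := pcatA p q r; rewrite Epq /= Ex.
by case: (pcat q r) => //= qr Ey; exists qr.
Qed.

Lemma pcat_data p q x : pcat p q = Some x ->
  [/\ psrc x = psrc p, ptgt x = ptgt q & plen x = (plen p + plen q)%N].
Proof.
case: (eqVneq (ptgt p) (psrc q)) => [pq | /pcatN-> //].
have [y -> Vy] := pcatE pq; move=> [<-].
rewrite /psrc /ptgt /plen Vy size_cat walk_end_cat; split=> //.
by move: pq; rewrite /ptgt /psrc => ->.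
Qed.

Lemma plen0 p : plen p = 0%N -> p = vpath (psrc p).
Proof.
move=> p0; apply: val_inj; rewrite /= /psrc; move: p0; rewrite /plen /=.
by case: (qpath_val p) => v [].
Qed.

Definition subpath q p : Prop :=
  exists r s rq, pcat r q = Some rq /\ pcat rq s = Some p.

Lemma subpath_refl p : subpath p p.
Proof.
exists (vpath (psrc p)), (vpath (ptgt p)), p.
by rewrite pcat1p pcatp1 !eqxx.
Qed.

Lemma subpath_trans q p p' : subpath q p -> subpath p p' -> subpath q p'.
Proof.
move=> [r [s [rq [Erq Ep]]]] [r' [s' [rp [Erp Ep']]]].
have [a Ea Erp'] := pcat_assocl Ep Erp.
have [b Eb Ea'] := pcat_assocl Erq Ea.
have [c _ Ec] := pcat_assocr Erp' Ep'.
by exists b, c, a.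
Qed.

Lemma subpath_catl r p x : pcat r p = Some x -> subpath p x.
Proof.
by move=> Ex; exists r, (vpath (ptgt x)), x; rewrite pcatp1 eqxx.
Qed.

Lemma subpath_catr p s x : pcat p s = Some x -> subpath p x.
Proof.
by move=> Ex; exists (vpath (psrc p)), s, p; rewrite pcat1p eqxx.
Qed.

Lemma subpath_len q p : subpath q p -> (plen q <= plen p)%N.
Proof.
move=> [r [s [rq [/pcat_data[_ _ E1] /pcat_data[_ _ ->]]]]].
by rewrite E1 addnAC leq_addl.
Qed.

(** The two complementary factors have length 0, so they are vertices and act
    as identities. *)
Lemma subpath_eq_len q p : subpath q p -> plen q = plen p -> q = p.
Proof.
move=> [r [s [rq [E1 E2]]]].
have [_ _ L1] := pcat_data E1; have [_ _ L2] := pcat_data E2.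
rewrite L2 L1 addnAC -[LHS]add0n => /addIn/esym/eqP.
rewrite addn_eq0 => /andP[/eqP/plen0 r0 /eqP/plen0 s0].
move: E1 E2; rewrite r0 s0 pcat1p pcatp1.
by case: ifP => // _ [<-]; case: ifP => // _ [].
Qed.

Lemma subpath_anti p q : subpath p q -> subpath q p -> p = q.
Proof.
move=> pq qp; apply: (subpath_eq_len pq); apply/eqP.
by rewrite eqn_leq !subpath_len.
Qed.

End Subpaths.

(** * Ideals of the path algebra and monomial ideals *)

Section PathAlgebra.
Variables (K : fieldType) (Q : quiver).
Local Notation KQ := (path_alg K Q).
Implicit Types (x y : KQ) (p q : qpath Q) (I J : set KQ) (S T : set (qpath Q)).

Lemma mcoeff_pelt p q : (pelt K p)@_q = (p == q)%:R.
Proof. exact: mcoeffU. Qed.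

Lemma msupp_pelt p q : (q \in msupp (pelt K p)) = (q == p).
Proof.
rewrite -mcoeff_neq0 mcoeff_pelt [q == p]eq_sym.
by case: (p == q); rewrite ?oner_eq0 ?eqxx.
Qed.

Lemma path_algE x : x = \sum_(p <- msupp x) x@_p *: pelt K p.
Proof.
rewrite {1}[x]monalgE; apply: eq_bigr => p _.
by apply/malgP => k; rewrite mcoeffZ !mcoeffU mulr_natr.
Qed.

Lemma msupp_sum_sub (A : eqType) (r : seq A) (F : A -> KQ) k :
  k \in msupp (\sum_(i <- r) F i) -> exists2 i, i \in r & k \in msupp (F i).
Proof.
elim: r => [|a r IH]; first by rewrite big_nil msupp0.
rewrite big_cons => /(fsubsetP (msuppD_le _ _)).
rewrite inE => /orP[ka|/IH[i ir ki]].
  by exists a; rewrite ?mem_head.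
by exists i; rewrite // inE ir orbT.
Qed.

Lemma msupp_mul x y k : k \in msupp (x * y) ->
  exists p q, [/\ p \in msupp x, q \in msupp y & pcat p q = Some k].
Proof.
move=> /msupp_sum_sub[p px] /msupp_sum_sub[q qy].
rewrite /pmul2; case E: pcat => [r|]; last by rewrite msupp0.
move=> kr; exists p, q; split=> //; rewrite E; congr Some; move: kr.
by move=> /(fsubsetP msuppU_le); rewrite inE => /eqP->.
Qed.

(** The ring being unital, scaling is multiplication by a multiple of 1. *)
Lemma idealZ I (Iid : is_ideal I) c x : I x -> I (c *: x).
Proof.
by move=> Ix; rewrite -[x]mul1r [c *: _]pa_scalerAl; apply: idealMl.
Qed.

Lemma idealB I (Iid : is_ideal I) x y : I x -> I y -> I (x - y).
Proof.
by move=> Ix Iy; apply: idealD => //; rewrite -scaleN1r; apply: idealZ.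
Qed.

Lemma ideal_sum I (Iid : is_ideal I) (A : eqType) (r : seq A) (F : A -> KQ) :
  (forall i, i \in r -> I (F i)) -> I (\sum_(i <- r) F i).
Proof.
move=> IF; rewrite big_seq; apply: big_ind => //; first exact: ideal0.
by move=> x y; apply: idealD.
Qed.

Lemma ideal_gen_ideal (X : set KQ) : is_ideal (ideal_gen X).
Proof.
split.
- by move=> I Iid _; apply: ideal0.
- by move=> x y Jx Jy I Iid XI; apply: idealD => //; [apply: Jx | apply: Jy].
- by move=> a x Jx I Iid XI; apply: idealMl => //; apply: Jx.
- by move=> a x Jx I Iid XI; apply: idealMr => //; apply: Jx.
Qed.

Lemma pelt_cat p q r : pcat p q = Some r -> pelt K p * pelt K q = pelt K r.
Proof. by move=> E; rewrite pelt_mul E. Qed.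

Lemma ideal_subpath I (Iid : is_ideal I) q p :
  subpath q p -> I (pelt K q) -> I (pelt K p).
Proof.
move=> [r [s [rq [/pelt_cat E1 /pelt_cat <-]]]] Iq; rewrite -E1.
by apply: idealMr => //; apply: idealMl.
Qed.

(** The elements supported on paths with a subpath in [S] form an ideal, as
    multiplying by a path can only enlarge the paths of the support; and each
    path [r t s] with [t] in [S] is in the ideal generated by [S]. *)
Lemma path_idealE S x :
  path_ideal K S x <-> forall p, p \in msupp x -> exists2 t, S t & subpath t p.
Proof.
split=> [Sx|xS].
  apply: (Sx [set y | forall p, p \in msupp y -> exists2 t, S t & subpath t p]).
    split=> /=.
    - by move=> p; rewrite msupp0.
    - move=> y z Hy Hz p /(fsubsetP (msuppD_le _ _)).
      by rewrite inE => /orP[/Hy|/Hz].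
    - move=> a y Hy p /msupp_mul[r [q [_ /Hy[t St tq] /subpath_catl qp]]].
      by exists t => //; apply: subpath_trans qp.
    - move=> a y Hy p /msupp_mul[q [r [/Hy[t St tq] _ /subpath_catr qp]]].
      by exists t => //; apply: subpath_trans qp.
  move=> _ [t St <-] p /=; rewrite msupp_pelt => /eqP->.
  by exists t => //; apply: subpath_refl.
have Sid : is_ideal (path_ideal K S) by apply: ideal_gen_ideal.
rewrite [x]path_algE; apply: ideal_sum => // p /xS[t St tp].
apply: (idealZ Sid); apply: (ideal_subpath Sid tp).
by move=> J _ XJ; apply: XJ; exists t.
Qed.

Lemma pelt_path_ideal S p :
  path_ideal K S (pelt K p) <-> exists2 t, S t & subpath t p.
Proof.
rewrite path_idealE; split=> [Sp|Sp q]; first by apply: Sp; rewrite msupp_pelt.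
by rewrite msupp_pelt => /eqP->.
Qed.

(** Each [s] in [S] has a subpath [t] in [T], which has itself a subpath in
    [S]; the latter is [s] because [S] is an antichain, so [s = t].  Hence
    [S] is contained in [T], and minimality of [T] gives equality. *)
Lemma min_path_gen_antichain S T :
    (forall s s', S s -> S s' -> subpath s s' -> s = s') ->
  min_path_gen (path_ideal K S) T -> T = S.
Proof.
move=> Santi [TS Tmin]; apply/esym/Tmin => // s Ss.
have : path_ideal K S (pelt K s).
  by apply/pelt_path_ideal; exists s => //; apply: subpath_refl.
rewrite -TS => /pelt_path_ideal[t Tt ts].
have : path_ideal K T (pelt K t).
  by apply/pelt_path_ideal; exists t => //; apply: subpath_refl.
rewrite TS => /pelt_path_ideal[s' Ss' s't].
have Es := Santi _ _ Ss' Ss (subpath_trans s't ts).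
by rewrite Es in s't; rewrite (subpath_anti s't ts).
Qed.

(** If [x = v x w], the paths of [x] all start at [v] and end at [w]. *)
Lemma uniform_parallel x p q : uniform x -> p \in msupp x -> q \in msupp x ->
  psrc p = psrc q /\ ptgt p = ptgt q.
Proof.
move=> [_ [v [w Ex]]].
suff ends k : k \in msupp x -> psrc k = v /\ ptgt k = w.
  by move=> /ends[-> ->] /ends[-> ->].
rewrite Ex => /msupp_mul[a [b [/msupp_mul[c [d []]]]]].
rewrite !msupp_pelt => /eqP-> _ /pcat_data[Ea _ _] /eqP-> /pcat_data[-> -> _].
by rewrite Ea.
Qed.

End PathAlgebra.

(** * Division and reduction with respect to an admissible order *)

Section Groebner.
Variables (K : fieldType) (Q : quiver) (gt : qpath Q -> qpath Q -> Prop).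
Hypothesis gt_adm : length_admissible gt.
Local Notation KQ := (path_alg K Q).
Implicit Types (x m : KQ) (p q t : qpath Q) (I J G : set KQ) (T : set (qpath Q)).

Lemma gt_wf : well_founded (fun q p => gt p q).
Proof.
move=> p; apply: contrapT => nAp.
have [m nAm min] := la_least gt_adm (S := [set q | ~ Acc (fun q p => gt p q) q])
  (ex_intro _ p nAp).
apply: nAm; constructor=> q mq; apply: contrapT => /min[qm|qm].
  by rewrite qm in mq; apply: la_irr mq.
by apply: (la_irr gt_adm (p := m)); apply: la_trans mq qm.
Qed.

Lemma tip_exists x : x != 0 -> exists p, is_tip gt x p.
Proof.
move=> x0; suff H (r : seq (qpath Q)) : r != [::] ->
    exists2 p, p \in r & forall q, q \in r -> q <> p -> gt p q.
  have [|p px pmax] := H (msupp x); last by exists p.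
  by apply: contra_neq x0 => x0; rewrite [x]path_algE x0 big_nil.
elim: r => // a [|b r] IH _.
  by exists a; rewrite ?mem_head // => q; rewrite inE => /eqP.
have [//|p pr pmax] := IH.
have [ap|ap] := EM (a = p).
  exists p; first by rewrite inE pr orbT.
  by move=> q; rewrite inE => /orP[/eqP->//|]; apply: pmax.
have [gap|gpa] := la_total gt_adm ap.
  exists a; first by rewrite mem_head.
  move=> q; rewrite inE => /orP[/eqP//|qr] _.
  have [->//|qp] := EM (q = p); exact: la_trans gap (pmax _ qr qp).
exists p; first by rewrite inE pr orbT.
by move=> q; rewrite inE => /orP[/eqP->//|]; apply: pmax.
Qed.

(** The division algorithm.  If the tip of [x] is [p = r t s], subtracting the
    multiple of [r (t - m) s] that cancels [p] leaves an element of [I] with a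
    smaller tip, because the order is compatible with multiplication by [r]
    and [s]; well-foundedness makes the process end. *)
Lemma ideal_sub_division I J :
    is_ideal I -> is_ideal J -> J `<=` I ->
    (forall p, tips gt I p -> exists t m,
       [/\ subpath t p, J (pelt K t - m) & forall n, n \in msupp m -> gt t n]) ->
  I `<=` J.
Proof.
move=> Iid Jid JI Jtip x Ix.
have [->|x0] := eqVneq x 0; first exact: ideal0.
have [p] := tip_exists x0; elim/(well_founded_ind gt_wf): p => p IH in x Ix x0 *.
move=> tip_xp; have [t [m [tp Jt tm]]] := Jtip p (ex_intro2 _ _ x Ix tip_xp).
have [r [s [rt [Ert Ep]]]] := tp.
pose y := pelt K r * (pelt K t - m) * pelt K s.
have Jy : J (x@_p *: y).
  by apply: idealZ => //; apply: idealMr => //; apply: idealMl.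
have Ey : y = pelt K p - pelt K r * m * pelt K s.
  by rewrite /y mulrBr mulrBl (pelt_cat _ Ert) (pelt_cat _ Ep).
rewrite -[x](subrK (x@_p *: y)); apply: idealD => //.
have [->|z0] := eqVneq (x - x@_p *: y) 0; first exact: ideal0.
have [q tip_q] := tip_exists z0.
(* A path of [x - x_p y] is either a path of [x] other than [p], or some
   [r n s] with [n] in the support of [m]. *)
apply: (IH q) => //; last by apply: idealB => //; apply: JI.
case: tip_xp tip_q => px pmax [qz _].
have [qx|qx] := boolP ((q \in msupp x) && (q != p)).
  by case/andP: qx => qx /eqP; apply: pmax.
have : q \in msupp (pelt K r * m * pelt K s).
  move: qz; apply: contraLR; rewrite -!mcoeff_eq0 => /eqP rms0.
  rewrite mcoeffB mcoeffZ Ey mcoeffB rms0 subr0 mcoeff_pelt.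
  have [<-|pq] := eqVneq p q; first by rewrite mulr1 subrr.
  by rewrite mulr0 subr0 mcoeff_eq0; move: qx; rewrite eq_sym pq andbT.
move=> /msupp_mul[rn [s' [/msupp_mul[r' [n []]]]]].
rewrite !msupp_pelt => /eqP-> /tm tn Ern /eqP-> Eq.
exact: la_mulr (la_mull gt_adm tn Ert Ern) Ep Eq.
Qed.

(** Dividing [x] by the coefficient of its tip turns it into a rule that
    rewrites the tip into smaller paths of [x]. *)
Lemma monic_tip I (Iid : is_ideal I) x p : I x -> is_tip gt x p ->
  exists2 m, I (pelt K p - m) &
    forall n, n \in msupp m -> n \in msupp x /\ gt p n.
Proof.
move=> Ix [px pmax]; exists (pelt K p - (x@_p)^-1 *: x).
  by rewrite opprB addrC subrK; apply: idealZ.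
have xp0 : x@_p != 0 by rewrite mcoeff_neq0.
move=> n; rewrite -mcoeff_neq0 mcoeffB mcoeffZ mcoeff_pelt.
have [<-|pn] := eqVneq p n; first by rewrite mulVf // subrr eqxx.
rewrite sub0r oppr_eq0 mulf_eq0 negb_or mcoeff_neq0 => /andP[_ nx].
by split=> //; apply: pmax => //; apply/eqP; rewrite eq_sym.
Qed.

Section Quadratic.
Variable T : set (qpath Q).
Hypothesis T2 : forall t, T t -> plen t = 2%N.

(** A path of length 2 has no other subpath of length 2 than itself, so being
    a tip of the monomial ideal amounts to belonging to [T]. *)
Lemma nontip_quadratic n : plen n = 2%N -> nontips K gt T n <-> ~ T n.
Proof.
move=> n2; split=> [nn Tn | nTn [x Tx [nx _]]].
  apply: nn; exists (pelt K n).
    by apply/pelt_path_ideal; exists n => //; apply: subpath_refl.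
  by split=> [|q]; rewrite msupp_pelt // => /eqP.
have [t Tt tn] := (path_idealE _ _).1 Tx _ nx.
by apply: nTn; rewrite -(subpath_eq_len tn) // n2 T2.
Qed.

Lemma N2E n : N2 K gt T n <-> ~ T n /\ plen n = 2%N.
Proof. by split=> -[H n2]; split=> //; apply/(nontip_quadratic n2). Qed.

(** The rewriting of the paths of [T] is iterated until no path of [T] is left;
    each path only gives smaller ones, and those of [T] are eliminated by
    well-founded induction. *)
Lemma reduce_quadratic I (Iid : is_ideal I) :
    (forall t, T t -> exists m, [/\ I (pelt K t - m) &
       forall n, n \in msupp m ->
         [/\ plen n = 2%N, gt t n, psrc n = psrc t & ptgt n = ptgt t]]) ->
  forall t, T t -> exists2 m, I (pelt K t - m) &
    forall n, n \in msupp m -> N2_of K gt T t n.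
Proof.
move=> IT.
(* The induction has to go through all the paths of length 2: a path outside
   [T] is its own normal form, whence the equality allowed on the order. *)
suff red q : plen q = 2%N -> exists2 m, I (pelt K q - m) &
    forall n, n \in msupp m ->
    [/\ N2 K gt T n, n = q \/ gt q n, psrc n = psrc q & ptgt n = ptgt q].
  move=> t Tt; have [m Im mP] := red _ (T2 Tt); exists m => // n /mP.
  by move=> [nN [nt|tn] ns nt']; split=> //; case/N2E: nN; rewrite nt.
elim/(well_founded_ind gt_wf): q => q IH q2.
have [Tq|nTq] := EM (T q); last first.
  exists (pelt K q); first by rewrite subrr; apply: ideal0.
  by move=> n; rewrite msupp_pelt => /eqP->; split=> //; [apply/N2E | left].
have [m [Im mP]] := IT q Tq.
have /choice[f fP] n : exists m', n \in msupp m -> I (pelt K n - m') /\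
    forall n', n' \in msupp m' -> N2_of K gt T q n'.
  have [/mP[n2 qn ns nt]|nm] := boolP (n \in msupp m); last by exists 0.
  have [m' Im' m'P] := IH n qn n2; exists m' => _; split=> // n' /m'P.
  move=> [n'N nn' n's n't]; split; rewrite ?n's ?n't //.
  by case: nn' => [-> //|]; apply: la_trans qn.
exists (\sum_(n <- msupp m) m@_n *: f n).
  rewrite -(subrK m (pelt K q)) -addrA; apply: idealD => //.
  rewrite {1}[m]path_algE -sumrB; apply: ideal_sum => // n /fP[In _].
  by rewrite -scalerBr; apply: idealZ.
move=> n' /msupp_sum_sub[n /fP[_ nP]] /(fsubsetP (msuppZ_le _ _)) /nP[*].
by split=> //; right.
Qed.

(** The coordinates of [X] are the coefficients of the [r t]: the pairs [(t, n)]
    that index the affine space exhaust the paths that [r t] may involve. *)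
Lemma gelt_reduced (r : qpath Q -> KQ) :
    (forall t, T t -> forall n, n \in msupp (r t) -> N2_of K gt T t n) ->
  exists X : affine_space K gt T, forall t, T t -> gelt X t = pelt K t - r t.
Proof.
move=> rP; pose X : affine_space K gt T := [ffun i => (r (pair_t i))@_(pair_n i)].
exists X => t Tt; congr (_ - _); apply/malgP => k.
rewrite raddf_sum /=.
have [/(rP _ Tt) [[kN k2] tk ks kt]|kr] := boolP (k \in msupp (r t)); last first.
  rewrite [RHS]mcoeff_outdom // big1 // => i /eqP it.
  rewrite mcoeffZ mcoeff_pelt ffunE it; case: eqP => [->|]; rewrite ?mulr0 //.
  by rewrite (mcoeff_outdom kr) mul0r.
pose tn : npath Q 2 * npath Q 2 :=
  (exist _ t (introT eqP (T2 Tt)), exist _ k (introT eqP k2)).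
have Ptn : `[< T (val tn.1) /\ N2_of K gt T (val tn.1) (val tn.2) >].
  by apply/asboolP; split.
pose i0 : pairTN K gt T := exist _ tn Ptn.
rewrite (bigD1 i0) //= mcoeffZ mcoeff_pelt eqxx mulr1 ffunE big1 ?addr0 //.
move=> i /andP[/eqP it ii0]; rewrite mcoeffZ mcoeff_pelt.
case: eqP => [ik|]; rewrite ?mulr0 //; case/eqP: ii0.
apply: val_inj; case: i it ik => -[a b] Pab it ik /=.
by congr pair; apply: val_inj.
Qed.

End Quadratic.

End Groebner.

(** * Strong Koszul algebras as points of an affine space *)

Theorem corollary3p3 (K : fieldType) (Q : quiver)
    (gt : qpath Q -> qpath Q -> Prop) (gt_adm : length_admissible gt)
    (I : set (path_alg K Q)) (I_sk : strong_koszul gt I)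
    (T : set (qpath Q)) (T_min : min_path_gen (path_ideal K (tips gt I)) T) :
  in_GrAlg gt T I.
Proof.
have [[Iid _] [G [GI Gunif Gtips] Gquad]] := I_sk.
have G2 t : tips gt G t -> plen t = 2%N by move=> [g /Gquad g2 [/g2]].
have TG : T = tips gt G.
  apply: (@min_path_gen_antichain K); last by rewrite Gtips.
  by move=> s s' /G2 s2 /G2 s'2 /subpath_eq_len; apply; rewrite s2.
have T2 t : T t -> plen t = 2%N by rewrite TG; apply: G2.
split=> //.
have IT t : T t -> exists m, [/\ I (pelt K t - m) & forall n, n \in msupp m ->
    [/\ plen n = 2%N, gt t n, psrc n = psrc t & ptgt n = ptgt t]].
  rewrite TG => -[g Gg g_tip]; have [m Im mP] := monic_tip Iid (GI _ Gg) g_tip.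
  exists m; split=> // n /mP[ng tn]; have [_ g_unif] := Gunif _ Gg.
  by have [] := uniform_parallel g_unif ng g_tip.1; split=> //; apply: Gquad ng.
have /choice[r rP] t : exists m, T t -> I (pelt K t - m) /\
    forall n, n \in msupp m -> N2_of K gt T t n.
  have [Tt|] := EM (T t); last by exists 0.
  by have [m] := reduce_quadratic gt_adm T2 Iid IT Tt; exists m.
have [X XE] := gelt_reduced T2 (fun t Tt => (rP t Tt).2).
suff IX : I = ideal_gen (gset X) by exists X => //; rewrite /GrAlg /= -IX.
have XI : ideal_gen (gset X) `<=` I.
  move=> x; apply=> // _ [t Tt <-]; rewrite XE //; exact: (rP t Tt).1.
apply/seteqP; split=> //.
apply: (ideal_sub_division gt_adm Iid (ideal_gen_ideal _) XI) => p Ip.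
have : path_ideal K (tips gt I) (pelt K p).
  by apply/pelt_path_ideal; exists p => //; apply: subpath_refl.
rewrite -T_min.1 => /pelt_path_ideal[t Tt tp]; exists t, (r t); split=> //.
  by rewrite -XE // => J _; apply; exists t.
by move=> n /(rP t Tt).2[].
Qed.
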